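(* Let $A$ be a unitary finite dimensional algebra with trace $\mathrm{tr}$ over a field $F$ of characteristic zero. Suppose $A\in\mathrm{var}^{tr}(B)$, where $B\in\{D_2^{t_{\alpha',\beta}},D_2^{t_{\gamma,\gamma}},D_2^{t_{\delta,0}},C_2^{t_{\epsilon,1}}\}$ for some $\alpha',\beta,\gamma,\delta\in F\setminus\{0\}$ with $\alpha'\ne\beta$, and $\epsilon\in F$. Then either $A\sim_{T^{tr}}B$ or $A\sim_{T^{tr}}C_k^{t_{\alpha,0}}$ for some $k\ge1$, where $\alpha=\mathrm{tr}(1_A)$.
   Context: All algebras are associative, unitary, over $F$. An algebra with trace is an algebra $A$ with a linear map $\mathrm{tr}\colon A\to F$ such that $\mathrm{tr}(ab)=\mathrm{tr}(ba)$ for all $a,b\in A$; $F$ is identified with $F\cdot 1_A\subseteq A$. Let $X=\{x_1,x_2,\dots\}$ and let $\mathcal M$ be the set of (nonempty) monomials in the noncommuting variables of $X$. The free algebra with trace is $F\langle X,\mathrm{Tr}\rangle\cong F\langle X\rangle\otimes F[\mathrm{Tr}(M)\mid M\in\mathcal M]$, where the $\mathrm{Tr}(M)$ are central commuting variables subject to $\mathrm{Tr}(MN)=\mathrm{Tr}(NM)$ and $\mathrm{Tr}(\mathrm{Tr}(M)N)=\mathrm{Tr}(M)\mathrm{Tr}(N)$. Its elements are trace polynomials. A trace polynomial is a trace identity of $A$ if it vanishes whenever the variables are replaced by arbitrary elements of $A$ and $\mathrm{Tr}$ by $\mathrm{tr}$; $\mathrm{Id}^{tr}(A)$ is the set of trace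 identities of $A$. The variety $\mathrm{var}^{tr}(B)$ is the class of algebras with trace satisfying all trace identities of $B$ (so $A\in\mathrm{var}^{tr}(B)$ iff $\mathrm{Id}^{tr}(B)\subseteq\mathrm{Id}^{tr}(A)$). $A\sim_{T^{tr}}B$ means $\mathrm{Id}^{tr}(A)=\mathrm{Id}^{tr}(B)$. $D_2$ is the algebra of $2\times2$ diagonal matrices over $F$, and $D_2^{t_{\alpha_1,\alpha_2}}$ is $D_2$ with trace $\mathrm{diag}(a_{11},a_{22})\mapsto\alpha_1a_{11}+\alpha_2a_{22}$. $C_2^{t_{\epsilon,1}}$ is the algebra of matrices $\begin{pmatrix}a&b\\0&a\end{pmatrix}$, $a,b\in F$, with trace $\begin{pmatrix}a&b\\0&a\end{pmatrix}\mapsto\epsilon a+b$. For $k\ge1$, $C_k$ is the algebra of $k\times k$ upper triangular Toeplitz matrices over $F$, i.e. matrices whose $(i,j)$ entry is $a_{j-i+1}$ for $j\ge i$ and $0$ for $j<i$, with $a_1,\dots,a_k\in F$ (so $C_k\cong F[x]/(x^k)$); $C_k^{t_{\alpha,0}}$ is $C_k$ with the trace sending such a matrix to $\alpha a_1$. *)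

(* Defs.v *)
From HB Require Import structures.
From mathcomp Require Import all_boot all_order all_algebra all_field.
From mathcomp Require Import ring finmap.
From mathcomp.multinomials Require Import monalg.

Set Implicit Arguments.
Unset Strict Implicit.
Unset Printing Implicit Defensive.

Import GRing.Theory.
Local Open Scope ring_scope.
Local Open Scope quotient_scope.

(* An algType satisfies 1 != 0, so the scalars embed into the algebra. *)
Record traceAlg (F : fieldType) := TraceAlg {
  tcarrier :> algType F;
  ttr : {scalar tcarrier};
  ttrC : forall a b : tcarrier, ttr (a * b) = ttr (b * a)
}.

Definition nemonom := {M : {fmonom nat} | (M : seq nat) != [::]}.

Definition cyc_eq (u v : nemonom) : bool :=
  has (fun k => rot k (val u) == val v :> seq nat) (iota 0 (size (val u))).

Lemma cyc_eq_rot (u v : nemonom) :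
  reflect (exists k, rot k (val u) = val v :> seq nat) (cyc_eq u v).
Proof.
apply: (iffP hasP) => [[k _ /eqP kE] | [k kE]]; first by exists k.
have u0 : (0 < size (val u))%N by rewrite lt0n size_eq0 (valP u).
have [k_lt | k_ge] := ltnP k (size (val u)).
  by exists k; rewrite ?mem_iota ?kE.
by exists 0%N; rewrite ?mem_iota // rot0 -kE rot_oversize.
Qed.

Lemma cyc_eqP (u v : nemonom) :
  reflect (exists M N : seq nat,
             (val u : seq nat) = M ++ N /\ (val v : seq nat) = N ++ M)
          (cyc_eq u v).
Proof.
apply: (iffP (cyc_eq_rot u v)) => [[k <-] | [M [N [-> ->]]]].
  by exists (take k (val u)), (drop k (val u)); rewrite cat_take_drop.
by exists (size M); rewrite rot_size_cat.
Qed.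

Fact cyc_eq_equiv : equiv_class_of cyc_eq.
Proof.
split=> [u | u v | v u w].
- by apply/cyc_eqP; exists [::], (val u); rewrite cats0.
- by apply/cyc_eqP/cyc_eqP => -[M [N [? ?]]]; exists N, M.
move=> /cyc_eq_rot[k kE] /cyc_eq_rot[l lE]; apply/cyc_eq_rot.
by exists (rot_add (val u) k l); rewrite -rot_rot_add kE.
Qed.

Canonical cyc_eq_equivRel := EquivRelPack cyc_eq_equiv.

(* The index set of the variables Tr(M): nonempty monomials up to
   MN ~ NM (lemma cyc_eqP). *)
Definition cycmonom := {eq_quot cyc_eq}.
HB.instance Definition _ := Choice.on cycmonom.

(* trpure is F[Tr(M) | M]; the free algebra with trace F<X> (x) F[Tr(M) | M] is
   the free associative algebra in x_0, x_1, ... over it. *)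
Definition trpure (F : fieldType) := {malg F[{cmonom cycmonom}]}.
Definition trpoly (F : fieldType) := {malg (trpure F)[{fmonom nat}]}.

Definition tpvar (F : fieldType) (i : nat) : trpoly F := << fmu i >>.
Definition tpTr (F : fieldType) (M : nemonom) : trpoly F :=
  (<< ucm (\pi_cycmonom M) >> : trpure F)%:MP.

Section Eval.
Variables (F : fieldType) (A : traceAlg F) (rho : nat -> A).

Definition evmon (w : {fmonom nat}) : A := \prod_(i <- w) rho i.

Definition evtrmon (m : {cmonom cycmonom}) : F :=
  \prod_(c <- finsupp m) ttr A (evmon (val (repr c))) ^+ m c.

Definition evtrpure (p : trpure F) : F := mmap idfun evtrmon p.

Definition tpeval (f : trpoly F) : A := mmap (fun p => (evtrpure p)%:A) evmon f.

Lemma evmon_cyc (u v : nemonom) :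
  cyc_eq u v -> ttr A (evmon (val u)) = ttr A (evmon (val v)).
Proof.
by case/cyc_eqP=> [M [N [uE vE]]]; rewrite /evmon uE vE !big_cat /= ttrC.
Qed.

Lemma tpeval_var i : tpeval (tpvar F i) = rho i.
Proof.
rewrite /tpeval /mmap /tpvar msuppU oner_eq0 big_seq_fset1 mcoeffUU.
rewrite /evtrpure [X in X%:A]/mmap msuppU oner_eq0 big_seq_fset1 mcoeffUU.
by rewrite /evtrmon mdom1 big_seq_fset0 mulr1 scale1r mul1r /evmon fmU big_seq1.
Qed.

(* The value does not depend on the representative chosen in evtrmon. *)
Lemma tpeval_Tr M : tpeval (tpTr F M) = (ttr A (evmon (val M)))%:A.
Proof.
have U0 (c : cycmonom) : (<< ucm c >> : trpure F) != 0.
  by rewrite -msupp_eq0 msuppU oner_eq0 -cardfs_eq0 cardfs1.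
rewrite /tpeval /mmap /tpTr msuppU (negPf (U0 _)) big_seq_fset1 mcoeffUU.
rewrite /evmon fm1 big_nil mulr1 -/(evmon _).
rewrite /evtrpure /mmap msuppU oner_eq0 big_seq_fset1 mcoeffUU mul1r.
rewrite /evtrmon mdomU big_seq_fset1 cmUU expr1; congr (_%:A).
by apply: evmon_cyc; apply/eqmodP; rewrite reprK.
Qed.

End Eval.

Section Variety.
Variable F : fieldType.

Definition trace_identity (A : traceAlg F) (f : trpoly F) : Prop :=
  forall rho : nat -> A, tpeval rho f = 0.

Definition in_trvar (B A : traceAlg F) : Prop :=
  forall f, trace_identity B f -> trace_identity A f.

Definition trequiv (A B : traceAlg F) : Prop :=
  forall f, trace_identity A f <-> trace_identity B f.

End Variety.

Section D2.
Variable F : fieldType.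

Definition diag2_pred : {pred 'M[F]_2} := fun M => is_diag_mx M.

Lemma diag2_subalg : GRing.subsemialg_closed diag2_pred.
Proof.
split=> [||a M|M N].
- exact: scalar_mx_is_diag.
- split=> [|M N]; first exact: mx0_is_diag.
  move=> /is_diag_mxP dM /is_diag_mxP dN; apply/is_diag_mxP => i j ij.
  by rewrite mxE dM // dN // addr0.
- move=> /is_diag_mxP dM; apply/is_diag_mxP => i j ij.
  by rewrite mxE dM // mulr0.
move=> /is_diag_mxP dM /is_diag_mxP dN; apply/is_diag_mxP => i j ij.
rewrite mxE big1 // => k _; have [ik|ik] := eqVneq i k.
  by rewrite dN ?mulr0 // -ik.
by rewrite dM ?mul0r.
Qed.

HB.instance Definition _ :=
  GRing.isSubalgClosed.Build F 'M[F]_2 diag2_pred diag2_subalg.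

Record diag2 := Diag2 { diag2_val : 'M[F]_2; _ : diag2_val \in diag2_pred }.
HB.instance Definition _ := [isSub for diag2_val].
HB.instance Definition _ := [Choice of diag2 by <:].
HB.instance Definition _ := [SubChoice_isSubAlgebra of diag2 by <:].

Variables a1 a2 : F.

Definition diag2_tr (M : diag2) : F := a1 * val M 0 0 + a2 * val M 1 1.

Fact diag2_tr_linear : scalar diag2_tr.
Proof. by move=> c M N; rewrite /diag2_tr !linearP !mxE; ring. Qed.

HB.instance Definition _ :=
  GRing.isLinear.Build F diag2 F *%R diag2_tr diag2_tr_linear.

Fact diag2_trC (M N : diag2) : diag2_tr (M * N) = diag2_tr (N * M).
Proof.
rewrite /diag2_tr !rmorphM /= -!mulmxE !mxE !big_ord_recl !big_ord0 /=.
case: M N => [M /is_diag_mxP dM] [N /is_diag_mxP dN] /=.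
have e1 : lift ord0 ord0 = 1 :> 'I_2 by apply/val_inj.
by rewrite e1 !(dM 0 1, dM 1 0, dN 0 1, dN 1 0) //; ring.
Qed.

Definition D2 : traceAlg F := @TraceAlg F diag2 diag2_tr diag2_trC.

End D2.

Section Toeplitz.
Variables (F : fieldType) (n : nat).

(* The (i, j) entry is a_(j-i+1) for i <= j and 0 otherwise, where a_(l+1) is
   the entry of index l in the first row. *)
Definition toeplitz_pred : {pred 'M[F]_n.+1} := fun M =>
  [forall i, forall j, M i j == if (i <= j)%N then M 0 (inord (j - i)) else 0].

Lemma toeplitzP (M : 'M[F]_n.+1) :
  reflect (exists a : nat -> F,
             forall i j, M i j = if (i <= j)%N then a (j - i)%N else 0)
          (M \in toeplitz_pred).
Proof.
apply: (iffP idP) => [/forallP TM | [a aE]].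
  exists (fun l => M 0 (inord l)) => i j.
  by have /forallP/(_ j)/eqP := TM i.
apply/forallP => i; apply/forallP => j; apply/eqP; rewrite aE.
case: leqP => // ij; rewrite aE /= inordK ?subn0 //.
by rewrite ltnS (leq_trans (leq_subr _ _)) // -ltnS.
Qed.

Lemma toeplitz_mul (M N : 'M[F]_n.+1) (a b : nat -> F) :
    (forall i j, M i j = if (i <= j)%N then a (j - i)%N else 0) ->
    (forall i j, N i j = if (i <= j)%N then b (j - i)%N else 0) ->
  forall i j, (M *m N) i j =
    if (i <= j)%N then \sum_(l < (j - i).+1) a l * b (j - i - l)%N else 0.
Proof.
move=> aE bE i j; rewrite mxE.
under eq_bigr => k _ do rewrite aE bE.
case: leqP => [ij | ji]; last first.
  rewrite big1 // => k _; case: leqP => [ik | _]; last by rewrite mul0r.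
  by rewrite leqNgt (leq_trans ji ik) mulr0.
pose G k := (if (i <= k)%N then a (k - i)%N else 0) *
            (if (k <= j)%N then b (j - k)%N else 0).
rewrite -(big_mkord xpredT G) (@big_cat_nat _ _ _ i) //=; last first.
  by rewrite ltnW.
rewrite big_nat big1 ?add0r; last first.
  by move=> k /andP[_ ki]; rewrite /G leqNgt ki mul0r.
rewrite (@big_cat_nat _ _ _ j.+1) //=; last by rewrite (leq_trans ij).
rewrite [X in _ + X]big_nat [X in _ + X]big1 ?addr0; last first.
  by move=> k /andP[jk _]; rewrite /G [(k <= j)%N]leqNgt jk mulr0.
rewrite -{1}[i : nat]add0n big_addn -subSn // big_mkord.
apply: eq_bigr => l _; have lj : (l <= j - i)%N by rewrite -ltnS -subSn.
rewrite /G leq_addl addnK [(l + i)%N]addnC -leq_subRL // lj.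
by rewrite subnDA.
Qed.

Lemma toeplitz_subalg : GRing.subsemialg_closed toeplitz_pred.
Proof.
split=> [||c M|M N].
- apply/toeplitzP; exists (fun l => (l == 0%N)%:R) => i j.
  rewrite mxE; case: leqP => [ij | ji].
    by rewrite subn_eq0 -val_eqE eqn_leq ij.
  by rewrite -val_eqE gtn_eqF.
- split=> [|M N].
    by apply/toeplitzP; exists (fun=> 0) => i j; rewrite mxE if_same.
  move=> /toeplitzP[a aE] /toeplitzP[b bE]; apply/toeplitzP.
  exists (fun l => a l + b l) => i j; rewrite mxE aE bE.
  by case: leqP; rewrite // addr0.
- move=> /toeplitzP[a aE]; apply/toeplitzP.
  by exists (fun l => c * a l) => i j; rewrite mxE aE; case: leqP; rewrite // mulr0.
move=> /toeplitzP[a aE] /toeplitzP[b bE]; apply/toeplitzP.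
exists (fun m => \sum_(l < m.+1) a l * b (m - l)%N) => i j.
exact: toeplitz_mul aE bE i j.
Qed.

HB.instance Definition _ :=
  GRing.isSubalgClosed.Build F 'M[F]_n.+1 toeplitz_pred toeplitz_subalg.

(* The algebra C_(n+1). *)
Record toeplitz :=
  Toeplitz { toeplitz_val : 'M[F]_n.+1; _ : toeplitz_val \in toeplitz_pred }.
HB.instance Definition _ := [isSub for toeplitz_val].
HB.instance Definition _ := [Choice of toeplitz by <:].
HB.instance Definition _ := [SubChoice_isSubAlgebra of toeplitz by <:].

Lemma toeplitzC (M N : toeplitz) : M * N = N * M.
Proof.
apply/val_inj; rewrite !rmorphM /= -!mulmxE.
case: M N => [M /toeplitzP[a aE]] [N /toeplitzP[b bE]] /=.
apply/matrixP => i j; rewrite (toeplitz_mul aE bE) (toeplitz_mul bE aE).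
case: leqP => // _; rewrite (reindex_inj rev_ord_inj) /=.
apply: eq_bigr => l _; rewrite subSS mulrC subKn //.
by rewrite -ltnS.
Qed.

Variable alpha : F.

Definition toeplitz_tr (M : toeplitz) : F := alpha * val M 0 0.

Fact toeplitz_tr_linear : scalar toeplitz_tr.
Proof.
by move=> c M N; rewrite /toeplitz_tr !linearP !mxE; ring.
Qed.

HB.instance Definition _ :=
  GRing.isLinear.Build F toeplitz F *%R toeplitz_tr toeplitz_tr_linear.

Fact toeplitz_trC (M N : toeplitz) : toeplitz_tr (M * N) = toeplitz_tr (N * M).
Proof. by rewrite toeplitzC. Qed.

(* C_(n+1) with the trace t_(alpha,0). *)
Definition Ctr : traceAlg F := @TraceAlg F toeplitz toeplitz_tr toeplitz_trC.

End Toeplitz.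

Section C2.
Variables (F : fieldType) (e : F).

Definition C2_tr (M : toeplitz F 1) : F := e * val M 0 0 + val M 0 1.

Fact C2_tr_linear : scalar C2_tr.
Proof. by move=> c M N; rewrite /C2_tr !linearP !mxE; ring. Qed.

HB.instance Definition _ :=
  GRing.isLinear.Build F (toeplitz F 1) F *%R C2_tr C2_tr_linear.

Fact C2_trC (M N : toeplitz F 1) : C2_tr (M * N) = C2_tr (N * M).
Proof. by rewrite toeplitzC. Qed.

(* C_2 with the trace t_(e,1). *)
Definition C2 : traceAlg F := @TraceAlg F (toeplitz F 1) C2_tr C2_trC.

End C2.

(* Main.v *)
From HB Require Import structures.
Require Import Defs.
From mathcomp Require Import all_boot all_order all_algebra all_field.
From mathcomp Require Import ring finmap.
From mathcomp.multinomials Require Import monalg.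
From Stdlib Require Import Classical.

Set Implicit Arguments.
Unset Strict Implicit.
Unset Printing Implicit Defensive.

Import GRing.Theory.
Local Open Scope ring_scope.

(** Everything is governed by the rank of the trace form (x, y) |-> tr(xy).

    The algebras D_2 with two nonzero weights and C_2 are of the form
    B = F + Fv with v^2 = d, tr(1) = sigma, tr(v) = s, and their trace form is
    nondegenerate: sigma^2 d - s^2 <> 0.  Such a B satisfies trace identities
    which say that it is two-dimensional (id_span), what tr(1) is (id_unit) and
    what the remaining invariant lambda = 4d / (sigma^2 d - s^2) is (id_disc);
    for D_2 with weights a and b one finds lambda = 1/(ab), and lambda = 0 for
    C_2.  Let A lie in the variety of B, and tau = tr(1_A).

    - If tau tr(x^2) <> tr(x)^2 for some x in A, then id_span, evaluated at 1
      and x, forces A = F + Fx, and the two other identities show that A and B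
      have the same sigma and lambda (quad_rank2).  These determine the pair
      (d, s) up to the rescaling (c^2 d, c s) of v when s <> 0.  When s = 0
      they leave d free up to a nonzero factor, which may be a nonsquare; but the
      values of a trace polynomial at points p + c q v are polynomial in c, so it
      cannot tell two nonzero values of d apart.  Hence A and B have the same
      identities (quad_trvar).

    - Otherwise tau tr(xy) = tr(x) tr(y) on A.  If tau = 0 then tr = 0, and A
      is equivalent to C_1 = F with the zero trace, because over an infinite
      field a commutative algebra has no polynomial identities beyond those of F
      (tr0_trequiv).  If tau <> 0 then tr/tau is a character of A; let N be its
      kernel.  If the elements of N have bounded nilpotency index, with least
      bound k, then A is equivalent to C_k (nil_ker_trequiv).  For the above B,
      id_disc and id_integral bound the index (quad_nil_ker).

    The algebra D_2 with weights delta and 0 satisfies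
    delta tr(xy) = tr(x) tr(y), so that only the second case arises; there, an
    unbounded nilpotency index lets elements of N imitate the idempotent
    diag(0, 1), and A has the same identities as D_2 (D2_degenerate).

    Two devices transport identities.  If B is generated by one element v_B,
    the value of a trace polynomial at any point of B lifts to a polynomial g
    in one variable, and specializing that variable to elements of A for which
    traces are computed in the same way yields values of the same trace
    polynomial on A (specialization_trvar).  If instead the arguments are to
    range over a commutative algebra with several generators, a polynomial that
    vanishes on all tuples of scalars vanishes on the algebra
    (comm_poly_vanish). *)

(** * Evaluation is a ring morphism *)

Definition tpC (F : fieldType) (c : F) : trpoly F := (c%:MP : trpure F)%:MP.

Definition word (i : nat) (s : seq nat) : nemonom :=
  exist (fun M : {fmonom nat} => (M : seq nat) != [::]) (FMonom (i :: s)) isT.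

Section EvalMorphism.
Variables (F : fieldType) (A : traceAlg F) (rho : nat -> A).

Lemma evmon_mmorphism : mmorphism (evmon rho).
Proof.
by split=> [u w|]; rewrite /evmon ?fm1 ?big_nil // fmM big_cat.
Qed.

Lemma evtrmonEw (d : {fset cycmonom}) (m : {cmonom cycmonom}) :
  (finsupp m `<=` d)%fset ->
  evtrmon rho m = \prod_(c <- d) ttr A (evmon rho (val (repr c))) ^+ m c.
Proof.
move=> md; rewrite /evtrmon (big_fset_incl _ md) // => c _.
by rewrite -cmE_eq0 => /eqP ->.
Qed.

Lemma evtrmon_mmorphism : mmorphism (evtrmon rho).
Proof.
split=> [m n|]; last by rewrite /evtrmon mdom1 big_seq_fset0.
pose d := (finsupp m `|` finsupp n)%fset.
rewrite !(@evtrmonEw d) /d ?mdomD ?fsubsetUl ?fsubsetUr //.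
by rewrite -big_split /=; apply: eq_bigr => c _; rewrite cmM exprD.
Qed.

HB.instance Definition _ :=
  isMultiplicative.Build _ _ (evmon rho) evmon_mmorphism.
HB.instance Definition _ :=
  isMultiplicative.Build _ _ (evtrmon rho) evtrmon_mmorphism.
HB.instance Definition _ := GRing.RMorphism.copy (evtrpure rho)
  (mmap (idfun : F -> F) (evtrmon rho)).

Let ev (p : trpure F) : A := (evtrpure rho p)%:A.

(* The coefficients are evaluated into scalars, hence commute with everything,
   which is what multiplicativity of the evaluation into A rests on. *)
HB.instance Definition _ := GRing.RMorphism.copy ev (in_alg A \o evtrpure rho).

HB.instance Definition _ := GRing.Additive.copy (tpeval rho)
  (mmap ev (evmon rho)).

Lemma tpeval_multiplicative : multiplicative (tpeval rho).
Proof.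
have cf (h : trpoly F) m m' : GRing.comm (ev h@_m) (evmon rho m').
  by rewrite /GRing.comm /ev comm_alg.
exact: (commr_mmap_is_multiplicative cf).
Qed.

HB.instance Definition _ :=
  GRing.isMultiplicative.Build _ _ (tpeval rho) tpeval_multiplicative.

Lemma tpevalC c : tpeval rho (tpC c) = c%:A.
Proof.
rewrite -[LHS]/(mmap ev (evmon rho) _) mmapC; congr (_ %:A).
by rewrite -[LHS]/(mmap (idfun : F -> F) (evtrmon rho) _) mmapC.
Qed.

End EvalMorphism.

(** * A syntax for explicit trace polynomials *)

(** Reflecting the identities through this syntax lets their values be computed
    by reduction in F and in the algebra, instead of in the quotients and finite
    maps that make up trpoly F.  Scalar expressions form a separate sort because
    their values lie in F. *)
Inductive sexpr (F : Type) :=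
  | STr of nat & seq nat
  | SConst of F
  | SSub of sexpr F & sexpr F
  | SMul of sexpr F & sexpr F.
Arguments STr {F}.

Inductive texpr (F : Type) :=
  | TVar of nat
  | TScal of sexpr F
  | TAdd of texpr F & texpr F
  | TSub of texpr F & texpr F
  | TMul of texpr F & texpr F.
Arguments TVar {F}.

Declare Scope sexpr_scope.
Delimit Scope sexpr_scope with sx.
Bind Scope sexpr_scope with sexpr.
Notation "e - f" := (SSub e f) : sexpr_scope.
Notation "e * f" := (SMul e f) : sexpr_scope.
Declare Scope texpr_scope.
Delimit Scope texpr_scope with tx.
Bind Scope texpr_scope with texpr.
Notation "e + f" := (TAdd e f) : texpr_scope.
Notation "e - f" := (TSub e f) : texpr_scope.
Notation "e * f" := (TMul e f) : texpr_scope.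

Arguments TScal {F} e%_sx.
Arguments SConst {F} c%_R.

Section Syntax.
Variable F : fieldType.

Fixpoint spoly (e : sexpr F) : trpoly F :=
  match e with
  | STr i s => tpTr F (word i s)
  | SConst c => tpC c
  | SSub e1 e2 => spoly e1 - spoly e2
  | SMul e1 e2 => spoly e1 * spoly e2
  end.

Fixpoint tpoly (e : texpr F) : trpoly F :=
  match e with
  | TVar i => tpvar F i
  | TScal e => spoly e
  | TAdd e1 e2 => tpoly e1 + tpoly e2
  | TSub e1 e2 => tpoly e1 - tpoly e2
  | TMul e1 e2 => tpoly e1 * tpoly e2
  end.

Section Values.
Variables (A : traceAlg F) (rho : nat -> A).

Fixpoint wprod (i : nat) (s : seq nat) : A :=
  if s is j :: s' then rho i * wprod j s' else rho i.

Fixpoint seval (e : sexpr F) : F :=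
  match e with
  | STr i s => ttr A (wprod i s)
  | SConst c => c
  | SSub e1 e2 => seval e1 - seval e2
  | SMul e1 e2 => seval e1 * seval e2
  end.

Fixpoint teval (e : texpr F) : A :=
  match e with
  | TVar i => rho i
  | TScal e => (seval e)%:A
  | TAdd e1 e2 => teval e1 + teval e2
  | TSub e1 e2 => teval e1 - teval e2
  | TMul e1 e2 => teval e1 * teval e2
  end.

Lemma tpeval_spoly e : tpeval rho (spoly e) = (seval e)%:A.
Proof.
elim: e => [i s|c|e1 IH1 e2 IH2|e1 IH1 e2 IH2] /=.
- rewrite tpeval_Tr; congr (ttr A _)%:A; rewrite /evmon /=.
  by elim: s i => [|j s IHs] i /=; rewrite big_cons ?big_nil ?mulr1 // IHs.
- exact: tpevalC.
- by rewrite rmorphB /= IH1 IH2 scalerBl.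
- by rewrite rmorphM /= IH1 IH2 -scalerAl mul1r scalerA.
Qed.

Lemma tpeval_tpoly e : tpeval rho (tpoly e) = teval e.
Proof.
elim: e => [i|e|e1 IH1 e2 IH2|e1 IH1 e2 IH2|e1 IH1 e2 IH2] /=.
- exact: tpeval_var.
- exact: tpeval_spoly.
- by rewrite rmorphD /= IH1 IH2.
- by rewrite rmorphB /= IH1 IH2.
- by rewrite rmorphM /= IH1 IH2.
Qed.

End Values.

Lemma trvar_texpr (A B : traceAlg F) (e : texpr F) :
    in_trvar B A -> (forall rho : nat -> B, teval rho e = 0) ->
  forall rho : nat -> A, teval rho e = 0.
Proof.
move=> AB e0 rho; rewrite -tpeval_tpoly; apply: AB => rho'.
by rewrite tpeval_tpoly.
Qed.

End Syntax.

(** * Quadratic algebras with trace and their identities *)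

Section Quad.
Variables (F : fieldType) (B : traceAlg F) (v : B) (d s sg lam : F).
Definition lin (p q : F) : B := p%:A + q *: v.

Record quad_pres : Prop := QuadPres {
  qp_sq : v * v = d%:A;
  qp_tr1 : ttr B 1 = sg;
  qp_trv : ttr B v = s }.

(** Kept apart from quad_pres, since specializing v to its multiples, zero
    included, keeps the relations but not the generation. *)
Definition quad_span : Prop := forall x : B, exists p, exists q, x = lin p q.

Hypothesis qB : quad_pres.

Lemma linC k : k%:A = lin k 0.
Proof. by rewrite /lin scale0r addr0. Qed.

Lemma linD p q p' q' : lin p q + lin p' q' = lin (p + p') (q + q').
Proof. by rewrite /lin addrACA !scalerDl. Qed.

Lemma linN p q : - lin p q = lin (- p) (- q).
Proof. by rewrite /lin opprD !scaleNr. Qed.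

Lemma linM p q p' q' :
  lin p q * lin p' q' = lin (p * p' + d * (q * q')) (p * q' + q * p').
Proof.
rewrite /lin mulrDl !mulrDr -!scalerAl -!scalerAr !mul1r mulr1 (qp_sq qB).
rewrite !scalerA [d * _]mulrC !scalerDl -!addrA; congr (_ + _).
by rewrite addrA addrC.
Qed.

Lemma tr_lin p q : ttr B (lin p q) = p * sg + q * s.
Proof. by rewrite /lin linearD !linearZ /= (qp_tr1 qB) (qp_trv qB). Qed.

Lemma lin_eq0 p q : p = 0 -> q = 0 -> lin p q = 0.
Proof. by move=> -> ->; rewrite /lin !scale0r addr0. Qed.

Definition id_comm : texpr F := TVar 0 * TVar 1 - TVar 1 * TVar 0.

(** The determinant with rows (tr(uw), tr(ux), u) for u = w, x, z: the three
    functionals tr(. w), tr(. x) and a coordinate are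
    dependent on a two-dimensional algebra.  When the Gram determinant of w and
    x is invertible it writes z as a combination of w and x. *)
Definition id_span : texpr F :=
  let T i j := STr i [:: j] in
  (TScal (T 0 0 * T 1 1 - T 0 1 * T 0 1) * TVar 2
  + TScal (T 0 1 * T 0 2 - T 0 0 * T 1 2) * TVar 1
  + TScal (T 0 1 * T 1 2 - T 1 1 * T 0 2) * TVar 0)%tx.

(** The determinant of the Gram matrix of (w, x, 1), with the constant sg in place
    of tr(1), since trace polynomials have no variable Tr(1).  It vanishes when
    the algebra is spanned by two elements and tr(1) = sg. *)
Definition id_unit : texpr F :=
  let T i j := STr i [:: j] in let t i := STr i [::] in
  (TScal ((T 0 0 * T 1 1 - T 0 1 * T 0 1) * SConst sg)
  + TScal ((T 0 1 * t 0 - T 0 0 * t 1) * t 1)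
  + TScal ((T 0 1 * t 1 - T 1 1 * t 0) * t 0))%tx.

(* The Gram determinant of 1 and x. *)
Let D : sexpr F :=
  (SConst sg * STr 0 [:: 0] - STr 0 [::] * STr 0 [::])%sx.

(** In coordinates, D = q^2 (sg^2 d - s^2) at x = p + qv, and R = 2pD, so that
    2Dx - R = 2Dqv.  Its square 4 D^2 q^2 d is lam D^3: the discriminant 4 q^2 d
    of x is lam D. *)
Definition id_disc : texpr F :=
  let R := (SConst sg * STr 0 [:: 0; 0] - STr 0 [::] * STr 0 [:: 0])%sx in
  let U := (TScal (SConst 2 * D) * TVar 0 - TScal R)%tx in
  (U * U - TScal (SConst lam * (D * (D * D))))%tx.

(** With U = sg x - tr(x) = q (sg v - s), one has
    U^2 + D = 2 q^2 sg (sg d - s v), whose square is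
    4 d q^2 sg^2 U^2 = lam D sg^2 U^2.  For sg <> 0 this makes x integral over
    its traces: it reads sg^4 x^4 = 0 as soon as tr(x) = tr(x^2) = 0. *)
Definition id_integral : texpr F :=
  let U := (TScal (SConst sg) * TVar 0 - TScal (STr 0 [::]))%tx in
  ((U * U + TScal D) * (U * U + TScal D)
  - TScal (SConst (sg * (sg * lam)) * D) * (U * U))%tx.

(* Turns an expression in elements of F + Fv into a single lin p q. *)
Let linE := (linC, linM, linN, linD, tr_lin).

Hypothesis spB : quad_span.

Lemma id_comm_quad (rho : nat -> B) : teval rho id_comm = 0.
Proof.
have [p0 [q0 E0]] := spB (rho 0); have [p1 [q1 E1]] := spB (rho 1).
rewrite /= E0 E1 !linE.
by apply: lin_eq0; ring.
Qed.

Lemma id_span_quad (rho : nat -> B) : teval rho id_span = 0.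
Proof.
have [p0 [q0 E0]] := spB (rho 0); have [p1 [q1 E1]] := spB (rho 1).
have [p2 [q2 E2]] := spB (rho 2).
rewrite /= E0 E1 E2 !linE.
by apply: lin_eq0; ring.
Qed.

Lemma id_unit_quad (rho : nat -> B) : teval rho id_unit = 0.
Proof.
have [p0 [q0 E0]] := spB (rho 0); have [p1 [q1 E1]] := spB (rho 1).
rewrite /= E0 E1 !linE.
by apply: lin_eq0; ring.
Qed.

(* The discriminant of v relative to its Gram determinant; unlike d and s it
   does not depend on the choice of v. *)
Hypothesis lamE : lam * (sg ^+ 2 * d - s ^+ 2) = 4 * d.

Lemma id_disc_quad (rho : nat -> B) : teval rho id_disc = 0.
Proof.
have [p [q E]] := spB (rho 0).
have lam0 : 4 * d - lam * (sg ^+ 2 * d - s ^+ 2) = 0 by rewrite lamE subrr.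
rewrite /= E !linE.
apply: lin_eq0; last by ring.
transitivity (q ^+ 6 * (sg ^+ 2 * d - s ^+ 2) ^+ 2
              * (4 * d - lam * (sg ^+ 2 * d - s ^+ 2))); first by ring.
by rewrite lam0 mulr0.
Qed.

Lemma id_integral_quad (rho : nat -> B) : teval rho id_integral = 0.
Proof.
have [p [q E]] := spB (rho 0).
have lam0 : 4 * d - lam * (sg ^+ 2 * d - s ^+ 2) = 0 by rewrite lamE subrr.
rewrite /= E !linE.
apply: lin_eq0.
  transitivity (q ^+ 4 * sg ^+ 2 * (sg ^+ 2 * d + s ^+ 2)
              * (4 * d - lam * (sg ^+ 2 * d - s ^+ 2))); first by ring.
  by rewrite lam0 mulr0.
transitivity (q ^+ 4 * sg ^+ 2 * (- 2 * sg * s)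
              * (4 * d - lam * (sg ^+ 2 * d - s ^+ 2))); first by ring.
by rewrite lam0 mulr0.
Qed.

End Quad.

(** * Polynomial functions over an infinite field *)

Section PolynomialFunctions.
Variables (F : fieldType) (charF : [pchar F] =i pred0).

(** The Vandermonde matrix of 0, 1, ..., n - 1 is invertible in characteristic
    zero. *)
Lemma polyfun_eq0 (V : lmodType F) n (u : nat -> V) :
    (forall c : F, \sum_(i < n) c ^+ i *: u i = 0) ->
  forall i, (i < n)%N -> u i = 0.
Proof.
move=> u0 i0 i0n; pose i := Ordinal i0n.
pose M := Vandermonde n (\row_(j < n) (j%:R : F)).
have Mu : M \in unitmx.
  rewrite unitmxE unitfE det_Vandermonde; apply/prodf_neq0 => k _.
  apply/prodf_neq0 => l kl; rewrite !mxE.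
  rewrite -natrB 1?ltnW // ((pcharf0P F).1 charF) -lt0n subn_gt0.
  exact: kl.
have -> : u i0 = \sum_(k < n) (M *m invmx M) k i *: u k.
  rewrite mulmxV // (bigD1 i) //= mxE eqxx scale1r big1 ?addr0 // => k ki.
  by rewrite mxE (negPf ki) scale0r.
under eq_bigr do rewrite mxE scaler_suml.
rewrite exchange_big big1 //= => j _.
under eq_bigr do rewrite mulrC -scalerA.
rewrite -scaler_sumr.
have -> : \sum_(k < n) M k j *: u k = \sum_(k < n) j%:R ^+ k *: u k.
  by apply: eq_bigr => k _; rewrite !mxE.
by rewrite u0 scaler0.
Qed.

Lemma horner_algE (A : algType F) (v : A) (g : {poly F}) :
  horner_alg v g = \sum_(i < size g) g`_i *: v ^+ i.
Proof.
rewrite -{1}[g]coefK poly_def linear_sum /=; apply: eq_bigr => i _.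
by rewrite -mul_polyC rmorphM rmorphXn /= horner_algC horner_algX mulr_algl.
Qed.

Lemma horner_alg_cons (A : algType F) (v : A) (g : {poly F}) c :
  horner_alg v (g * 'X + c%:P) = horner_alg v g * v + c%:A.
Proof. by rewrite rmorphD rmorphM /= horner_algX horner_algC. Qed.

Lemma horner_scale_eq0 (A : algType F) (v : A) (g : {poly F}) :
  (forall c, horner_alg (c *: v) g = 0) -> forall i, g`_i *: v ^+ i = 0.
Proof.
move=> g0 i; have [ilt|ige] := ltnP i (size g); last first.
  by rewrite nth_default // scale0r.
apply: (polyfun_eq0 (n := size g) (u := fun i => g`_i *: v ^+ i)) => // c.
rewrite -[RHS](g0 c) horner_algE; apply: eq_bigr => k _.
by rewrite exprZn !scalerA mulrC.
Qed.

Lemma prod_filter_count (R : pzRingType) (x : nat -> R) m w :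
    (forall a b : R, a * b = b * a) ->
  \prod_(i <- w) x i
    = x m ^+ count_mem m w * \prod_(i <- [seq i <- w | i != m]) x i.
Proof.
move=> xC; elim: w => [|i w IHw] /=; first by rewrite !big_nil mulr1.
rewrite big_cons IHw; have [->|im] /= := eqVneq i m.
  by rewrite mulrA -exprS.
by rewrite add0n big_cons !mulrA [x i * _]xC.
Qed.

(** A noncommutative polynomial with coefficients in A is given as a list of
    (coefficient, word) pairs.  The letters are replaced by elements of A one at
    a time: sorting the words by their degree in the last letter m, each
    homogeneous part vanishes at all scalars by polyfun_eq0, and it involves
    only letters below m. *)
Lemma comm_poly_vanish (A : algType F) (ws : seq (A * seq nat)) (x : nat -> A) :
    (forall a b : A, a * b = b * a) ->
    (forall c : nat -> F, \sum_(e <- ws) (\prod_(i <- e.2) c i) *: e.1 = 0) ->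
  \sum_(e <- ws) e.1 * \prod_(i <- e.2) x i = 0.
Proof.
move=> xC; have [m] : exists m, all (fun e : A * seq nat => all (gtn m) e.2) ws.
  elim: ws => [|[a w] ws [m IHm]]; first by exists 0%N.
  exists (maxn m (\max_(i <- w) i.+1)) => /=; apply/andP; split.
    by apply/allP => i iw; rewrite /= leq_max (leq_bigmax_seq (F := S)) ?orbT.
  apply: sub_all IHm => e; apply: sub_all => i /= im.
  by rewrite leq_max im.
elim: m ws => [|m IHm] ws wsm cw.
  have := cw (fun=> 0); rewrite !big_seq => {2}<-; apply: eq_bigr => -[a w] /=.
  move=> /(allP wsm); case: w => // _.
  by rewrite !big_nil mulr1 scale1r.
pose cnt (e : A * seq nat) := count_mem m e.2.
pose del (e : A * seq nat) : A * seq nat := (e.1, [seq i <- e.2 | i != m]).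
pose n := (\max_(e <- ws) cnt e).+1.
have cntn e : e \in ws -> (cnt e < n)%N by move=> ews; rewrite ltnS leq_bigmax_seq.
have slice (V : nmodType) (G : A * seq nat -> V) :
    \sum_(e <- ws) G e = \sum_(j < n) \sum_(e <- ws | cnt e == j) G e.
  under [RHS]eq_bigr do rewrite big_mkcond.
  rewrite exchange_big /= !big_seq; apply: eq_bigr => e /cntn en.
  by rewrite -big_mkcond (big_pred1 (Ordinal en)) // => j; rewrite -val_eqE eq_sym.
have cj (c : nat -> F) j : (j < n)%N ->
    \sum_(e <- ws | cnt e == j) (\prod_(i <- (del e).2) c i) *: e.1 = 0.
  apply: (polyfun_eq0
    (u := fun j => \sum_(e <- ws | cnt e == j) (\prod_(i <- (del e).2) c i) *: e.1)).
  move=> a; pose c' i := if i == m then a else c i.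
  rewrite -[RHS](cw c') slice; apply: eq_bigr => k _.
  rewrite scaler_sumr; apply: eq_bigr => e /eqP <-.
  rewrite (prod_filter_count c' m _ (@mulrC F)).
  rewrite /c' eqxx scalerA; congr (_ * _ *: _); rewrite !big_filter.
  by apply: eq_bigr => i /negPf ->.
rewrite slice big1 // => j _.
pose wj : seq (A * seq nat) := [seq del e | e <- ws & cnt e == j].
transitivity (x m ^+ j * \sum_(e <- wj) (e.1 * \prod_(i <- e.2) x i)).
  rewrite big_map big_filter mulr_sumr; apply: eq_bigr => e /eqP <- /=.
  by rewrite (prod_filter_count x m) // [LHS]mulrA [e.1 * x m ^+ _]xC -mulrA.
rewrite IHm ?mulr0 //; first last.
  by move=> c; rewrite /wj big_map big_filter; apply: cj.
apply/allP => f /mapP[e]; rewrite mem_filter => /andP[_ /(allP wsm) em -> {f}].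
rewrite /=; apply/allP => i; rewrite mem_filter => /andP[im /(allP em)] /=.
by rewrite ltnS leq_eqVlt (negPf im).
Qed.

End PolynomialFunctions.

(** * Transporting identities along one generator *)

Section Specialization.
Variable F : fieldType.

Lemma eq_evtrpure (A B : traceAlg F) (rho : nat -> A) (rho' : nat -> B) p :
    (forall w : nemonom, ttr A (evmon rho (val w)) = ttr B (evmon rho' (val w))) ->
  evtrpure rho p = evtrpure rho' p.
Proof.
move=> trE; rewrite /evtrpure /mmap; apply: eq_bigr => m _; congr (_ * _).
by rewrite /evtrmon; apply: eq_bigr => c _; rewrite trE.
Qed.

Section Generic.
Variables (r : nat -> {poly F}) (t : {poly F} -> {poly F}).

Let mon (w : {fmonom nat}) : {poly F} := \prod_(i <- w) r i.

(** The value of f at a point r of F[X], where Tr is interpreted by an F[X]-valued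
    map t because, when v varies, the trace of g(v) varies with it. *)
Definition polyeval (f : trpoly F) : {poly F} :=
  \sum_(w <- msupp f)
    (\sum_(m <- msupp f@_w) (f@_w)@_m *:
       \prod_(c <- finsupp m) t (mon (val (repr c))) ^+ m c) * mon w.

Lemma horner_polyeval (A : traceAlg F) (v : A) (rho : nat -> A) f :
    (forall g, (ttr A (horner_alg v g))%:A = horner_alg v (t g)) ->
    (forall i, rho i = horner_alg v (r i)) ->
  tpeval rho f = horner_alg v (polyeval f).
Proof.
move=> tE rE.
have monE w : evmon rho w = horner_alg v (mon w).
  by rewrite rmorph_prod; apply: eq_bigr => i _; rewrite rE.
rewrite rmorph_sum /tpeval /mmap; apply: eq_bigr => w _.
rewrite rmorphM /= monE; congr (_ * _).
rewrite rmorph_sum /evtrpure /mmap scaler_suml; apply: eq_bigr => m _.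
rewrite -mul_polyC rmorphM /= horner_algC rmorph_prod /= mulr_algl -scalerA.
congr (_ *: _); rewrite /evtrmon -[LHS]/(in_alg A _) rmorph_prod.
by apply: eq_bigr => c _; rewrite !rmorphXn /= monE tE.
Qed.

End Generic.

(** A point of B lifts to a point r of F[X] along X |-> vB.  The value g of f at
    r becomes, under X |-> vA y, the value of f at a point of A, which is 0; the
    last hypothesis then returns to B.  The family vA, as opposed to a single
    element, is what allows g to be killed by interpolation. *)
Lemma specialization_trvar (A B : traceAlg F) (T : Type) (vA : T -> A) (vB : B)
    (t : {poly F} -> {poly F}) :
    (forall x : B, exists g, x = horner_alg vB g) ->
    (forall g, (ttr B (horner_alg vB g))%:A = horner_alg vB (t g)) ->
    (forall y g, (ttr A (horner_alg (vA y) g))%:A = horner_alg (vA y) (t g)) ->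
    (forall g, (forall y, horner_alg (vA y) g = 0) -> horner_alg vB g = 0) ->
  in_trvar A B.
Proof.
move=> Bgen tB tA AB f fA rho.
have rP i : exists g, rho i == horner_alg vB g.
  by have [g ->] := Bgen (rho i); exists g.
rewrite (@horner_polyeval (fun i => xchoose (rP i)) t _ vB) //; last first.
  by move=> i; apply/eqP/(xchooseP (rP i)).
apply: AB => y.
rewrite -(@horner_polyeval _ _ _ _ (fun i => horner_alg (vA y) (xchoose (rP i)))) //.
Qed.

End Specialization.

(** * Quadratic algebras with equal invariants *)

Lemma two_neq0 (F : fieldType) (charF : [pchar F] =i pred0) : 2 != 0 :> F.
Proof. by rewrite ((pcharf0P F).1 charF). Qed.

Section QuadraticComparison.
Variables (F : fieldType) (charF : [pchar F] =i pred0).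
Local Notation two_neq0 := (two_neq0 charF).

Lemma horner_lin (A B : traceAlg F) (vA : A) (vB : B) d sA sB sgA sgB g :
    quad_pres vA d sA sgA -> quad_pres vB d sB sgB ->
  exists p, exists q, horner_alg vA g = lin vA p q /\ horner_alg vB g = lin vB p q.
Proof.
move=> qA qB; elim/poly_ind: g => [|g c [p [q [EA EB]]]].
  by exists 0, 0; rewrite !rmorph0 /lin !scale0r !addr0.
exists (d * q + c), p; rewrite !horner_alg_cons EA EB.
have linV (C : traceAlg F) (v : C) s sg : quad_pres v d s sg ->
    lin v p q * v + c%:A = lin v (d * q + c) p.
  move=> qC; rewrite (_ : lin v p q * v = lin v p q * lin v 0 1).
    by rewrite (linM qC) (linC v) linD; congr lin; ring.
  by rewrite {3}/lin scale0r add0r scale1r.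
by rewrite (linV _ _ _ _ qA) (linV _ _ _ _ qB).
Qed.

(** Pairing a relation p + qv = 0 with 1 and v under the trace form gives a linear
    system of determinant sg^2 d - s^2. *)
Lemma lin_inj (A : traceAlg F) (v : A) d s sg p q :
    quad_pres v d s sg -> sg ^+ 2 * d - s ^+ 2 != 0 -> lin v p q = 0 ->
  p = 0 /\ q = 0.
Proof.
move=> qA nd pq0.
have e1 : p * sg + q * s = 0 by rewrite -(tr_lin qA) pq0 linear0.
have e2 : p * s + q * d * sg = 0.
  rewrite addrC [q * d]mulrC -(tr_lin qA).
  rewrite (_ : lin v _ _ = lin v p q * lin v 0 1); last first.
    by rewrite (linM qA); congr lin; ring.
  by rewrite pq0 mul0r linear0.
have q0 : q = 0.
  apply/eqP; have : q * (sg ^+ 2 * d - s ^+ 2) == 0.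
    apply/eqP; transitivity (sg * (p * s + q * d * sg) - s * (p * sg + q * s)).
      by ring.
    by rewrite e1 e2; ring.
  by rewrite mulf_eq0 (negPf nd) orbF.
split=> //; move: e1 e2; rewrite q0 !mul0r !addr0 => /eqP.
rewrite mulf_eq0 => /orP[/eqP //|/eqP sg0] /eqP; rewrite mulf_eq0 => /orP[/eqP //|].
by move=> /eqP s0; move: nd; rewrite sg0 s0 !expr0n mul0r subrr eqxx.
Qed.

Lemma quad_scale (A : traceAlg F) (v : A) d s sg c :
  quad_pres v d s sg -> quad_pres (c *: v) (c ^+ 2 * d) (c * s) sg.
Proof.
case=> vv t1 tv; split=> //; last by rewrite linearZ /= tv.
by rewrite -scalerAl -scalerAr vv !scalerA.
Qed.

Lemma quad_iso_trvar (A B : traceAlg F) (vA : A) (vB : B) d s sg :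
    quad_pres vA d s sg -> quad_pres vB d s sg -> quad_span vB ->
    sg ^+ 2 * d - s ^+ 2 != 0 -> in_trvar A B.
Proof.
move=> qA qB spB nd.
have trE g : ttr A (horner_alg vA g) = ttr B (horner_alg vB g).
  have [p [q [-> ->]]] := horner_lin g qA qB.
  by rewrite (tr_lin qA) (tr_lin qB).
apply: (@specialization_trvar _ _ _ unit (fun=> vA) vB
          (fun g => (ttr B (horner_alg vB g))%:P)).
- move=> x; have [p [q ->]] := spB x; exists (p%:P + q *: 'X).
  by rewrite rmorphD -mul_polyC rmorphM /= !horner_algC horner_algX mulr_algl.
- by move=> g; rewrite horner_algC.
- by move=> _ g; rewrite horner_algC trE.
move=> g /(_ tt); have [p [q [-> ->]]] := horner_lin g qA qB.
by move=> /(lin_inj qA nd)[-> ->]; rewrite /lin !scale0r addr0.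
Qed.

(** A and B need not be isomorphic over F, as dB / dA may fail to be a square.
    But the trace kills odd powers of v, so that it is computed on polynomials by
    t(g) = sg (g(X) + g(-X)) / 2, whatever the square of v is.  Specializing X to
    all multiples of vA shows that the lifted value of an identity of A is 0 in
    F[X]. *)
Lemma quad_even_trvar (A B : traceAlg F) (vA : A) (vB : B) dA dB sg :
    quad_pres vA dA 0 sg -> quad_pres vB dB 0 sg -> quad_span vB ->
    dA != 0 -> in_trvar A B.
Proof.
move=> qA qB spB dA0.
pose t (g : {poly F}) := (sg / 2) *: (g + (g \Po - 'X)).
have tE (C : traceAlg F) (w : C) d g : quad_pres w d 0 sg ->
    (ttr C (horner_alg w g))%:A = horner_alg w (t g).
  move=> qC.
  have [p [q [E E']]] : exists p, exists q, horner_alg w g = lin w p q /\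
      horner_alg w (g \Po - 'X) = lin w p (- q).
    elim/poly_ind: g => [|g c [p [q [E E']]]].
      by exists 0, 0; rewrite comp_poly0 rmorph0 /lin !scale0r oppr0 scale0r addr0.
    have wE : w = lin w 0 1 by rewrite /lin scale0r add0r scale1r.
    exists (d * q + c), p.
    rewrite comp_polyD comp_polyM comp_polyX comp_polyC horner_alg_cons.
    rewrite rmorphD rmorphM rmorphN /= horner_algX horner_algC E E'.
    rewrite {2 5}wE (linC w) linN !(linM qC) !linD.
    by split; congr lin; ring.
  rewrite /t -mul_polyC rmorphM rmorphD /= horner_algC E E' (tr_lin qC).
  rewrite !(linC w) linD (linM qC).
  by congr lin; field; rewrite two_neq0.
apply: (@specialization_trvar _ _ _ F (fun c => c *: vA) vB t).
- move=> x; have [p [q ->]] := spB x; exists (p%:P + q *: 'X).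
  by rewrite rmorphD -mul_polyC rmorphM /= !horner_algC horner_algX mulr_algl.
- by move=> g; apply: tE qB.
- move=> c g; apply: (tE _ _ (c ^+ 2 * dA)).
  by rewrite -[X in quad_pres _ _ X](mulr0 c); apply: quad_scale.
move=> g /(horner_scale_eq0 charF) g0.
suff -> : g = 0 by rewrite rmorph0.
apply/polyP => i; rewrite coef0; apply/eqP; have /eqP := g0 i.
rewrite scaler_eq0 => /orP[//|/eqP vi0].
have : (vA * vA) ^+ i = 0 by rewrite exprMn_comm // vi0 mul0r.
rewrite (qp_sq qA) exprZn expr1n => /eqP; rewrite scaler_eq0 oner_eq0 orbF.
by rewrite expf_eq0 (negPf dA0) andbF.
Qed.

(** The relations read (lam sg^2 - 4) d = lam s^2.  If s <> 0 the factor
    lam sg^2 - 4 cannot vanish, so d is determined by s, and rescaling vA by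
    s / sA makes A and B isomorphic.  If s = 0 it vanishes, whence sA = 0 as
    well. *)
Lemma quad_trvar (A B : traceAlg F) (vA : A) (vB : B) dA sA d s sg lam :
    quad_pres vA dA sA sg -> quad_pres vB d s sg -> quad_span vB ->
    sg ^+ 2 * dA - sA ^+ 2 != 0 -> sg ^+ 2 * d - s ^+ 2 != 0 ->
    lam * (sg ^+ 2 * dA - sA ^+ 2) = 4 * dA ->
    lam * (sg ^+ 2 * d - s ^+ 2) = 4 * d ->
  in_trvar A B.
Proof.
move=> qA qB spB ndA nd lamA lamB.
have four0 : 4 != 0 :> F by rewrite ((pcharf0P F).1 charF).
have EA : (lam * sg ^+ 2 - 4) * dA = lam * sA ^+ 2.
  by apply/eqP; rewrite -subr_eq0 mulrBl -lamA; apply/eqP; ring.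
have EB : (lam * sg ^+ 2 - 4) * d = lam * s ^+ 2.
  by apply/eqP; rewrite -subr_eq0 mulrBl -lamB; apply/eqP; ring.
have [s0|s_neq0] := eqVneq s 0.
  have d0 : d != 0.
    by apply: contraNneq nd => ->; rewrite s0 expr0n mulr0 subrr.
  have lam4 : lam * sg ^+ 2 - 4 = 0.
    move/eqP: EB; rewrite s0 expr0n mulr0 mulf_eq0 (negPf d0) orbF.
    by move/eqP.
  have lam0 : lam != 0.
    by apply: contraNneq four0 => l0; rewrite -oppr_eq0 -lam4 l0 mul0r add0r.
  have sA0 : sA = 0.
    move/eqP: EA; rewrite lam4 mul0r eq_sym mulf_eq0 (negPf lam0) sqrf_eq0.
    by move/eqP.
  rewrite s0 in qB; rewrite sA0 in qA.
  apply: quad_even_trvar qA qB spB _.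
  by apply: contraNneq ndA => ->; rewrite sA0 expr0n mulr0 subrr.
have lam4 : lam * sg ^+ 2 - 4 != 0.
  apply: contraNneq four0 => l4; move/eqP: EB; rewrite l4 mul0r eq_sym.
  rewrite mulf_eq0 sqrf_eq0 (negPf s_neq0) orbF => /eqP l0.
  by rewrite -oppr_eq0 -l4 l0 mul0r add0r.
have sA0 : sA != 0.
  apply: contraNneq ndA => sA0; move/eqP: EA; rewrite sA0 expr0n mulr0.
  by rewrite mulf_eq0 (negPf lam4) => /eqP ->; rewrite mulr0 subrr.
apply: quad_iso_trvar (quad_scale (s / sA) qA) _ spB _; rewrite divfK //.
  suff -> : (s / sA) ^+ 2 * dA = d by [].
  apply: (mulfI lam4); rewrite EB mulrCA EA; field.
  by rewrite sA0.
suff -> : (s / sA) ^+ 2 * dA = d by [].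
by apply: (mulfI lam4); rewrite EB mulrCA EA; field.
Qed.

End QuadraticComparison.

(** * The algebras C_k *)

Section ToeplitzGenerator.
Variables (F : fieldType) (n : nat).

Let shift : 'M[F]_n.+1 := \matrix_(i, j) (j == i.+1 :> nat)%:R.

Fact shift_toeplitz : shift \in @toeplitz_pred F n.
Proof.
apply/toeplitzP; exists (fun l => (l == 1)%N%:R) => i j; rewrite mxE.
case: leqP => [ij|ji]; last by rewrite ltn_eqF // ltnS ltnW.
by rewrite -(eqn_add2r i (j - i) 1) subnK.
Qed.

Definition tshift : toeplitz F n := Toeplitz shift_toeplitz.

(** Matrix entries packaged as linear forms, to be applied to sums and scalar
    multiples in the algebra itself. *)
Definition tcoef (i j : 'I_n.+1) (x : toeplitz F n) : F := val x i j.

Fact tcoef_linear i j : scalar (tcoef i j).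
Proof. by move=> c x y; rewrite /tcoef linearP !mxE. Qed.

HB.instance Definition _ i j :=
  GRing.isLinear.Build F (toeplitz F n) F *%R (tcoef i j) (tcoef_linear i j).

Lemma tcoefP (x y : toeplitz F n) : (forall i j, tcoef i j x = tcoef i j y) -> x = y.
Proof. by move=> xy; apply/val_inj/matrixP. Qed.

Lemma tcoefX m (i j : 'I_n.+1) : tcoef i j (tshift ^+ m) = (j == i + m :> nat)%N%:R.
Proof.
rewrite /tcoef.
elim: m i j => [|m IHm] i j; first by rewrite expr0 addn0 mxE -val_eqE eq_sym.
rewrite exprS rmorphM /= -mulmxE mxE.
under eq_bigr do rewrite IHm mxE.
have [lt_in|] := ltnP i.+1 n.+1.
  rewrite (bigD1 (Ordinal lt_in)) //= eqxx mul1r big1 ?addr0 ?addSnnS // => k.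
  by rewrite -val_eqE /= => /negPf ->; rewrite mul0r.
rewrite ltnS => n_i; rewrite big1 => [|k _]; last first.
  by rewrite ltn_eqF ?mul0r // ltnS (leq_trans _ n_i) // -ltnS.
by rewrite ltn_eqF // addnS ltnS (leq_trans _ (leq_addr _ _)) // (leq_trans _ n_i) // -ltnS.
Qed.

Lemma tshift_nil m : (n < m)%N -> tshift ^+ m = 0.
Proof.
move=> nm; apply: tcoefP => i j.
by rewrite tcoefX linear0 ltn_eqF // (leq_trans (ltn_ord j)) // (leq_trans nm) ?leq_addl.
Qed.

Lemma tshift_gen (x : toeplitz F n) : exists g, x = horner_alg tshift g.
Proof.
have /toeplitzP[a aE] : val x \in @toeplitz_pred F n by case: x.
exists (\sum_(m < n.+1) a m *: 'X^m); apply: tcoefP => i j.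
rewrite rmorph_sum linear_sum /= {1}/tcoef aE.
have -> : \sum_(m < n.+1) tcoef i j (horner_alg tshift (a m *: 'X^m)) =
          \sum_(m < n.+1) a m * (j == i + m :> nat)%N%:R.
  apply: eq_bigr => m _.
  rewrite -mul_polyC rmorphM rmorphXn /= horner_algC horner_algX mulr_algl.
  by rewrite linearZ /= tcoefX.
case: leqP => [ij|ji].
  have lt_n : (j - i < n.+1)%N by rewrite (leq_ltn_trans (leq_subr _ _)).
  rewrite (bigD1 (Ordinal lt_n)) //= subnKC // eqxx mulr1 big1 ?addr0 // => k.
  rewrite -val_eqE /= => /negPf kij.
  have [jE|_] := eqVneq (j : nat) (i + k)%N; last by rewrite mulr0.
  by rewrite jE addKn eqxx in kij.
by rewrite big1 // => k _; rewrite ltn_eqF ?mulr0 // (leq_trans ji) ?leq_addr.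
Qed.

Lemma tcoef00M (x y : toeplitz F n) :
  tcoef 0 0 (x * y) = tcoef 0 0 x * tcoef 0 0 y.
Proof.
have /toeplitzP[a aE] : val x \in @toeplitz_pred F n by case: x.
have /toeplitzP[b bE] : val y \in @toeplitz_pred F n by case: y.
rewrite /tcoef rmorphM /= -mulmxE (toeplitz_mul aE bE) aE bE leqnn subnn.
by rewrite big_ord1 subn0.
Qed.

Lemma tcoef00_alg c : tcoef 0 0 c%:A = c.
Proof. by rewrite linearZ /= -(expr0 tshift) tcoefX mulr1. Qed.

Lemma tcoef00_horner g : tcoef 0 0 (horner_alg tshift g) = g`_0.
Proof.
elim/poly_ind: g => [|g c _]; first by rewrite !rmorph0 linear0 coef0.
rewrite horner_alg_cons linearD /= tcoef00M tcoef00_alg.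
by rewrite -[tshift in X in _ * X]expr1 tcoefX mulr0 add0r coefD coefMX coefC add0r.
Qed.

End ToeplitzGenerator.

Section ToeplitzVariety.
Variables (F : fieldType) (charF : [pchar F] =i pred0).

(** Specialize the generator of C_(n+1) to the multiples of y: the lifted value g
    of an identity satisfies g_i y^i = 0 for all i, so g_i = 0 for i <= n. *)
Lemma Ctr_in_trvar (A : traceAlg F) n alpha :
    (forall (y : A) g, ttr A y = 0 -> ttr A (horner_alg y g) = alpha * g`_0) ->
    (exists2 y : A, ttr A y = 0 & y ^+ n != 0) ->
  in_trvar A (Ctr n alpha).
Proof.
move=> trA [y0 y00 y0n].
apply: (@specialization_trvar F A (Ctr n alpha) {y : A | ttr A y == 0} sval
         (tshift F n) (fun g => (alpha * g`_0)%:P)).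
- exact: tshift_gen.
- move=> g; rewrite horner_algC; congr _%:A.
  by rewrite -[LHS]/(alpha * tcoef 0 0 _) tcoef00_horner.
- by case=> y /eqP y_0 g /=; rewrite trA // horner_algC.
move=> g g0; rewrite horner_algE big1 // => i _.
have [ni|] := ltnP n i; first by rewrite tshift_nil // scaler0.
move=> le_in; suff -> : g`_i = 0 by rewrite scale0r.
have gy c : horner_alg (c *: y0) g = 0.
  have cy : ttr A (c *: y0) == 0 by rewrite linearZ /= y00 mulr0.
  exact: (g0 (exist (fun y : A => ttr A y == 0) (c *: y0) cy)).
have /eqP := horner_scale_eq0 charF gy i.
rewrite scaler_eq0 => /orP[/eqP //|/eqP yi].
by move: y0n; rewrite -(subnK le_in) exprD yi mulr0 eqxx.
Qed.

Fixpoint expand (p : nat -> F) (w : seq nat) : seq (F * seq nat) :=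
  if w is i :: w' then
    [seq (p i * e.1, e.2) | e <- expand p w'] ++
    [seq (e.1, i :: e.2) | e <- expand p w']
  else [:: (1, [::])].

Lemma prod_expand (A : algType F) (p : nat -> F) (y : nat -> A) w :
  \prod_(i <- w) ((p i)%:A + y i)
    = \sum_(e <- expand p w) e.1 *: \prod_(i <- e.2) y i.
Proof.
elim: w => [|i w IHw] /=; first by rewrite big_seq1 !big_nil scale1r.
rewrite big_cons IHw big_cat !big_map mulrDl !mulr_sumr; congr (_ + _).
  by apply: eq_bigr => e _; rewrite mulr_algl scalerA.
by apply: eq_bigr => e _; rewrite big_cons scalerAr.
Qed.

(** Fix rho = p + y with p scalar and y nilpotent.  The traces depend on p only, so
    f becomes a polynomial in y, whose parts of degree above n vanish.  Those of
    degree at most n vanish at all y = c u with c scalar and u the generator of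
    C_(n+1), because the powers u^0, ..., u^n are independent; hence they vanish
    at y. *)
Lemma in_trvar_Ctr (A : traceAlg F) n alpha :
    (forall a b : A, a * b = b * a) ->
    (forall rho : nat -> A, exists p : nat -> F,
       (forall w, w != [::] ->
          ttr A (\prod_(i <- w) rho i) = alpha * \prod_(i <- w) p i) /\
       (forall w, (n < size w)%N -> \prod_(i <- w) (rho i - (p i)%:A) = 0)) ->
  in_trvar (Ctr n alpha) A.
Proof.
move=> AC pA f fC rho; have [p [trp nilp]] := pA rho.
pose y i := rho i - (p i)%:A.
pose K w := evtrpure rho f@_w.
pose ws := flatten [seq [seq (K w * e.1, e.2) | e <- expand p w] | w : {fmonom nat} <- msupp f].
have sum_ws (V : nmodType) (G : F * seq nat -> V) :
    \sum_(e <- ws) G e =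
    \sum_(w <- msupp f) \sum_(e <- expand p w) G (K w * e.1, e.2).
  by rewrite big_flatten big_map; apply: eq_bigr => w _; rewrite big_map.
have wsE (B : traceAlg F) (x z : nat -> B) :
    (forall i, x i = (p i)%:A + z i) ->
    (forall w, w != [::] -> ttr B (\prod_(i <- w) x i) = alpha * \prod_(i <- w) p i) ->
    tpeval x f = \sum_(e <- ws) e.1 *: \prod_(i <- e.2) z i.
  move=> xE trB; rewrite sum_ws /tpeval /mmap; apply: eq_bigr => w _.
  rewrite (eq_evtrpure (rho' := rho)) => [|u]; last first.
    by rewrite /evmon trB ?trp //; apply: (valP u).
  rewrite mulr_algl /evmon; under eq_bigr do rewrite xE.
  rewrite prod_expand scaler_sumr.
  by apply: eq_bigr => e _; rewrite scalerA.
rewrite (wsE A rho y) // => [|i]; last by rewrite /y addrC subrK.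
have slice0 (c : nat -> F) (l : 'I_n.+1) :
    \sum_(e <- ws | size e.2 == l) (\prod_(i <- e.2) c i) * e.1 = 0.
  pose x i : Ctr n alpha := (p i)%:A + c i *: tshift F n.
  have x00 w : tcoef 0 0 (\prod_(i <- w) x i) = \prod_(i <- w) p i.
    elim: w => [|i w IHw]; first by rewrite !big_nil -(scale1r 1) tcoef00_alg.
    rewrite !big_cons tcoef00M IHw /x linearD /= tcoef00_alg linearZ /=.
    by rewrite -[tshift F n]expr1 tcoefX mulr0 addr0.
  have := fC x; rewrite (wsE _ x (fun i => c i *: tshift F n)) // => [|w _]; last first.
    by rewrite -[LHS]/(alpha * tcoef 0 0 _) x00.
  move/(congr1 (tcoef 0 l)); rewrite linear_sum linear0 => ws0.
  rewrite -[RHS]ws0 big_mkcond /=; apply: eq_bigr => e _.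
  have -> : \prod_(i <- e.2) (c i *: tshift F n) =
            (\prod_(i <- e.2) c i) *: tshift F n ^+ size e.2.
    elim: (e.2) => [|i w IHw]; first by rewrite !big_nil scale1r.
    by rewrite !big_cons IHw -scalerAl -scalerAr scalerA -exprS.
  rewrite !linearZ /= tcoefX add0n eq_sym.
  by case: eqP => _; rewrite ?mulr1 ?mulr0 // mulrC.
rewrite (bigID (fun e => size e.2 <= n)%N) /= [X in _ + X]big1 ?addr0; last first.
  by move=> e; rewrite -ltnNge => /nilp; rewrite /y => ->; rewrite scaler0.
rewrite (partition_big (fun e => inord (size e.2) : 'I_n.+1) xpredT) //= big1 // => l _.
pose wl := [seq (e.1%:A : A, e.2) | e <- ws & size e.2 == l].
have := @comm_poly_vanish F charF A wl y AC.
rewrite big_map big_filter => vanish.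
rewrite -[RHS]vanish; last first.
  move=> c; rewrite big_map big_filter -[RHS](scale0r 1) -(slice0 c l) scaler_suml.
  by apply: eq_bigr => e _; rewrite scalerA.
apply: congr_big => // [e|e _]; last by rewrite mulr_algl.
apply/andP/eqP => [[le_n /eqP <-]|->]; first by rewrite inordK.
by rewrite -ltnS inord_val.
Qed.

End ToeplitzVariety.

(** * Trace forms of rank at most one *)

Section RankAtMostOne.
Variables (F : fieldType) (charF : [pchar F] =i pred0) (A : traceAlg F).
Hypothesis AC : forall a b : A, a * b = b * a.

(** Polarization of a^m = 0: in the vanishing product for (y + c z)^(k+1), the
    coefficient of c is (k + 1) y^k z times the remaining factors. *)
Lemma nil_prod_eq0 (N : A -> Prop) m (s : seq A) (y : A) k :
    (forall a b c, N a -> N b -> N (a + c *: b)) ->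
    (forall a, N a -> a ^+ m = 0) ->
    (forall a, a \in s -> N a) -> N y -> (k + size s)%N = m ->
  y ^+ k * \prod_(a <- s) a = 0.
Proof.
move=> NZ Nm; elim: s k y => [|z s IHs] k y Ns Ny km.
  by rewrite big_nil mulr1 -[k]addn0 km Nm.
have Nz : N z by apply: Ns; rewrite mem_head.
have {}IHs c : (y + c *: z) ^+ k.+1 * \prod_(a <- s) a = 0.
  apply: IHs; last by rewrite -km addSnnS.
    by move=> a sa; apply: Ns; rewrite inE sa orbT.
  exact: NZ.
pose P := \prod_(a <- s) a.
have binomE c : (y + c *: z) ^+ k.+1 * P =
    \sum_(i < k.+2) c ^+ i *: ((y ^+ (k.+1 - i) * z ^+ i * P) *+ 'C(k.+1, i)).
  rewrite exprDn_comm; last exact: AC.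
  rewrite mulr_suml; apply: eq_bigr => i _.
  by rewrite exprZn mulrnAl -!scalerAr -scalerAl scalerMnr.
have := @polyfun_eq0 _ charF _ k.+2
  (fun i => (y ^+ (k.+1 - i) * z ^+ i * P) *+ 'C(k.+1, i)) _ 1%N isT.
rewrite subn1 expr1 bin1 -scaler_nat big_cons mulrA => /(_ _)/eqP.
rewrite scaler_eq0 ((pcharf0P F).1 charF) /= => H; apply/eqP/H => c.
by rewrite -binomE.
Qed.

Hypothesis tr_rank1 : forall x y : A, ttr A 1 * ttr A (x * y) = ttr A x * ttr A y.

(** Over scalars as over A, only the part of f free of traces survives, evaluated at
    commuting elements. *)
Lemma tr0_trequiv : ttr A 1 = 0 -> trequiv A (Ctr 0 (ttr A 1)).
Proof.
move=> t1; have tr0 x : ttr A x = 0.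
  by have /eqP := tr_rank1 x x; rewrite t1 mul0r eq_sym mulf_eq0 orbb => /eqP.
rewrite t1 => f; split; move: f.
  apply: Ctr_in_trvar => //; first by move=> y g _; rewrite tr0 mul0r.
  by exists 1; rewrite ?expr0 ?oner_neq0.
move=> f fC rho.
have tpE (B : traceAlg F) (x : nat -> B) : (forall a, ttr B a = 0) ->
    tpeval x f = \sum_(w <- msupp f) evtrpure rho f@_w *: \prod_(i <- w) x i.
  move=> trB; apply: eq_bigr => w _; rewrite mulr_algl; congr (_ *: _).
  by apply: eq_evtrpure => u; rewrite trB tr0.
rewrite tpE //.
pose ws := [seq ((evtrpure rho f@_w)%:A : A, w : seq nat) | w <- msupp f].
have := @comm_poly_vanish F charF A ws rho AC; rewrite big_map => vanish.
rewrite -[RHS]vanish; first by apply: eq_bigr => w _; rewrite mulr_algl.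
move=> c; rewrite big_map.
have := fC (fun i => (c i)%:A); rewrite tpE => [|a]; last first.
  by rewrite -[LHS]/(0 * _) mul0r.
move/(congr1 (tcoef 0 0)); rewrite linear_sum linear0 => c0.
rewrite -[RHS](scale0r 1) -c0 scaler_suml; apply: eq_bigr => w _.
rewrite /= scalerA mulrC; congr (_ *: _).
have -> : \prod_(i <- w) (c i)%:A = (\prod_(i <- w) c i)%:A :> Ctr 0 0.
  by rewrite -[RHS]/(in_alg _ _) rmorph_prod.
by rewrite linearZ /= tcoef00_alg.
Qed.

Hypothesis t1 : ttr A 1 != 0.

Lemma trM_eq0 (x y : A) : ttr A y = 0 -> ttr A (x * y) = 0.
Proof. by move=> y0; apply: (mulfI t1); rewrite tr_rank1 y0 !mulr0. Qed.

Lemma tr_horner_ker (y : A) g : ttr A y = 0 -> ttr A (horner_alg y g) = ttr A 1 * g`_0.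
Proof.
move=> y0; elim/poly_ind: g => [|g c _]; first by rewrite rmorph0 linear0 coef0 mulr0.
rewrite horner_alg_cons linearD linearZ /= trM_eq0 // add0r.
by rewrite coefD coefMX coefC add0r mulrC.
Qed.

(** For the least m with y^(m+1) = 0 on the kernel N of the character tr / tr(1),
    some y in N with y^m <> 0 generates a copy of C_(m+1); and every point of A
    is a scalar point plus a point of N, where products of m + 1 factors
    vanish. *)
Lemma nil_ker_trequiv m : (forall y : A, ttr A y = 0 -> y ^+ m = 0) ->
  exists n, trequiv A (Ctr n (ttr A 1)).
Proof.
elim: m => [/(_ 0 (linear0 _))/eqP|m IHm Nm]; first by rewrite expr0 oner_eq0.
have [|/not_all_ex_not[y]] := classic (forall y : A, ttr A y = 0 -> y ^+ m = 0).
  exact: IHm.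
move=> H; have [y0 ym] := imply_to_and _ _ H; exists m => f; split; move: f.
  apply: (Ctr_in_trvar charF tr_horner_ker).
  by exists y => //; apply/eqP.
apply: (in_trvar_Ctr charF AC) => rho; exists (fun i => ttr A (rho i) / ttr A 1).
split=> [w _|w mw].
  elim: w => [|i w IHw]; first by rewrite !big_nil mulr1.
  rewrite !big_cons; apply: (mulfI t1); rewrite tr_rank1 IHw.
  by field.
pose y' i := rho i - (ttr A (rho i) / ttr A 1)%:A.
have ker_y' i : ttr A (y' i) = 0 by rewrite linearB linearZ /= divfK // subrr.
rewrite -(cat_take_drop m.+1 w) big_cat /=.
have := @nil_prod_eq0 (fun a => ttr A a = 0) m.+1 [seq y' i | i <- take m.+1 w] 0 0.
rewrite expr0 mul1r big_map => -> //; rewrite ?mul0r ?linear0 //.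
- by move=> a b c a0 b0; rewrite linearD linearZ /= a0 b0 mulr0 addr0.
- by move=> a /mapP[i _ ->].
by rewrite size_map size_takel.
Qed.

End RankAtMostOne.

(** * Varieties of nondegenerate quadratic algebras *)

Section Dichotomy.
Variables (F : fieldType) (charF : [pchar F] =i pred0) (A : traceAlg F).

Lemma rank1_polarize :
    (forall x : A, ttr A 1 * ttr A (x * x) = ttr A x * ttr A x) ->
  forall x y : A, ttr A 1 * ttr A (x * y) = ttr A x * ttr A y.
Proof.
move=> sq x y; have := sq (x + y).
rewrite mulrDl !mulrDr !linearD /= [ttr A (y * x)]ttrC !mulrDr.
rewrite !sq => E; apply: (mulfI (two_neq0 charF)).
move/eqP: E; rewrite -subr_eq0 => /eqP E.
by apply/eqP; rewrite -subr_eq0 -E; apply/eqP; ring.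
Qed.

Variables (B : traceAlg F) (v : B) (d s sg lam : F).
Hypotheses (qB : quad_pres v d s sg) (spB : quad_span v).
Hypothesis nd : sg ^+ 2 * d - s ^+ 2 != 0.
Hypothesis lamE : lam * (sg ^+ 2 * d - s ^+ 2) = 4 * d.
Hypothesis AB : in_trvar B A.

(** If tr(1) = sg, then sg is nonzero and id_integral gives y^4 = 0 on the kernel.
    Otherwise the scalar D of id_disc at 1 + z is the same nonzero constant for all
    z in the kernel, and id_disc makes (1 + 2z)^2 the constant lam D.  So z + z^2 = 0
    on the kernel; comparing z = y and z = 2y gives y^2 = 0. *)
Lemma quad_nil_ker :
    (forall x y : A, ttr A 1 * ttr A (x * y) = ttr A x * ttr A y) ->
    ttr A 1 != 0 ->
  exists m, forall y : A, ttr A y = 0 -> y ^+ m = 0.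
Proof.
move=> rk1 t1; have trM0 := trM_eq0 rk1 t1.
have [sgE|sg_t1] := eqVneq sg (ttr A 1).
  exists 4%N => y y0.
  have := trvar_texpr AB (id_integral_quad qB spB lamE) (fun=> y).
  rewrite /= trM0 // y0 !(mul0r, mulr0, subr0, addr0, scale0r) mulr_algl.
  rewrite -!(scalerAl, scalerAr) => /eqP.
  rewrite !scaler_eq0 sgE (negPf t1) /= => /eqP <-.
  by rewrite !exprS expr0 mulr1 !mulrA.
pose D := sg * ttr A 1 - ttr A 1 * ttr A 1.
have D0 : D != 0 by rewrite /D -mulrBl mulf_neq0 // subr_eq0.
have id4 z : ttr A z = 0 -> 4 *: (z + z * z) = (lam * D - 1)%:A.
  move=> z0; have := trvar_texpr AB (id_disc_quad qB spB lamE) (fun=> 1 + z).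
  have tr1 : ttr A (1 + z) = ttr A 1 by rewrite linearD /= z0 addr0.
  have tr2 : ttr A ((1 + z) * (1 + z)) = ttr A 1.
    by rewrite mulrDr mulr1 linearD /= tr1 trM0 // addr0.
  have tr3 : ttr A ((1 + z) * ((1 + z) * (1 + z))) = ttr A 1.
    by rewrite [X in _ * X]mulrDr mulr1 mulrDr linearD /= tr2 mulrA trM0 // addr0.
  rewrite /= tr1 tr2 tr3 -/D.
  have -> : (2 * D)%:A * (1 + z) - D%:A = D *: (1 + 2 *: z).
    rewrite mulr_algl mulr_natl mulr2n !scalerDr scalerA addrAC scalerDl addrK.
    by rewrite mulr_natr mulr2n.
  rewrite -scalerAl -scalerAr.
  have -> : (1 + 2 *: z) * (1 + 2 *: z) = 1 + 4 *: (z + z * z).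
    rewrite mulrDr mulr1 mulrDl mul1r -scalerAl -scalerAr scalerA scalerDr.
    by rewrite -!addrA -natrM; congr (_ + _); rewrite addrA -scalerDl -natrD.
  move=> E; have : (D * D) *: (1 + 4 *: (z + z * z) - (lam * D)%:A) == 0.
    rewrite -E scalerBr !scalerA; apply/eqP; congr (_ - _ *: _).
    by ring.
  rewrite scaler_eq0 mulf_eq0 orbb (negPf D0) subr_eq0 /= => /eqP E'.
  by rewrite scalerBl scale1r -E' addrAC subrr add0r.
(* The constant is found at z = 0. *)
have ker0 z : ttr A z = 0 -> z + z * z = 0.
  move=> z0; have := id4 0 (linear0 _); rewrite mul0r addr0 scaler0 => c0.
  have /eqP := id4 z z0; rewrite -c0 scaler_eq0 ((pcharf0P F).1 charF) /=.
  by move/eqP.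
exists 2%N => y y0.
have y2 := ker0 (2 *: y); have y1 := ker0 y y0.
have {y2} y2 : 2 *: y + (2 *: y) * (2 *: y) = 0 by apply: y2; rewrite linearZ /= y0 mulr0.
apply/eqP; have : 2 *: y ^+ 2 == 0; last by rewrite scaler_eq0 (negPf (two_neq0 charF)).
apply/eqP; rewrite -y2 expr2.
rewrite -scalerAl -scalerAr (_ : y * y = - y); last first.
  by apply/eqP; rewrite -addr_eq0 addrC y1.
rewrite !scalerN; set a := 2 *: y.
by rewrite scaler_nat mulr2n opprD addrA subrr add0r.
Qed.

(** U is the Gram determinant of 1 and x.  As it is nonzero, id_span at (1, x, z)
    expresses z through 1 and x, id_unit at (1, x) becomes U (sg - tr(1)) = 0, and
    id_disc at the element v' with scalar square shows that A has the same lam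
    as B. *)
Lemma quad_rank2 (x : A) : ttr A 1 * ttr A (x * x) != ttr A x * ttr A x ->
  in_trvar A B.
Proof.
rewrite -subr_eq0; set U := _ - _ => U0.
have spx z : exists p, exists q, z = lin x p q.
  have := trvar_texpr AB (id_span_quad qB spB) (nth 0 [:: 1; x; z]).
  rewrite /= !mul1r -/U; set P := (_ - _ : F); set Q := (_ - _ : F).
  rewrite !mulr_algl -addrA => /eqP; rewrite addr_eq0 => /eqP E.
  exists (- Q / U), (- P / U); apply: (scalerI U0).
  rewrite E /lin scalerDr !scalerA ![U * _]mulrC !divfK // !scaleNr.
  by rewrite opprD addrC.
have [b [c xx]] := spx (x * x).
(* Completing the square in x^2 = b + cx. *)
pose v' : A := x - (c / 2)%:A.
have two0 := two_neq0 charF.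
have v'v' : v' * v' = (b + (c / 2) ^+ 2)%:A.
  rewrite /v' mulrBr !mulrBl xx /lin mulr_algl mulr_algr mulr_algl scalerA.
  rewrite (_ : c *: x = (c / 2) *: x + (c / 2) *: x); last first.
    by rewrite -scalerDl -mulr2n -[_ *+ 2]mulr_natr divfK.
  rewrite scalerDl -expr2 opprB [b%:A + _]addrA addrK.
  by rewrite [_ - (c / 2) *: x]addrC addrA addrK.
have qA := QuadPres v'v' (erefl (ttr A 1)) (erefl (ttr A v')).
set dA := b + _ in v'v' qA; set sA := ttr A v' in qA.
have xE : x = lin v' (c / 2) 1 by rewrite /lin scale1r addrC subrK.
have UE : U = ttr A 1 ^+ 2 * dA - sA ^+ 2.
  by rewrite /U xE (linM qA) !(tr_lin qA); ring.
have t1E : ttr A 1 = sg.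
  have := trvar_texpr AB (id_unit_quad qB spB) (nth 0 [:: 1; x; 0]).
  rewrite /= !mul1r -/U => /eqP; rewrite -!scalerDl scaler_eq0 oner_eq0 orbF => E.
  have : U * (sg - ttr A 1) == 0.
    by apply/eqP; rewrite -(eqP E) /U; ring.
  by rewrite mulf_eq0 (negPf U0) subr_eq0 /= => /eqP.
rewrite t1E in qA UE; rewrite UE in U0.
apply: (quad_trvar charF qA qB spB U0 nd _ lamE).
have := trvar_texpr AB (id_disc_quad qB spB lamE) (fun=> v').
set D := sg ^+ 2 * dA - sA ^+ 2 in U0 *.
rewrite /= v'v' mulr_algr.
have trZ k (z : A) : ttr A (k *: z) = k * ttr A z by rewrite linearZ.
rewrite !trZ t1E -/sA.
have -> : sg * (dA * sg) - sA * sA = D by rewrite /D; ring.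
have -> : sg * (dA * sA) - sA * (dA * sg) = 0 by ring.
rewrite scale0r subr0 mulr_algl -scalerAl -scalerAr v'v' !scalerA -scalerBl.
move/eqP; rewrite scaler_eq0 oner_eq0 orbF => /eqP E.
have : D ^+ 2 * (lam * D - 4 * dA) == 0.
  by rewrite -oppr_eq0 -[X in _ == X]E; apply/eqP; ring.
by rewrite mulf_eq0 expf_eq0 (negPf U0) subr_eq0 => /eqP.
Qed.

Lemma quad_dichotomy :
  trequiv A B \/ exists2 k, (1 <= k)%N & trequiv A (Ctr k.-1 (ttr A 1)).
Proof.
have AC a b : a * b = b * a :> A.
  have := trvar_texpr AB (id_comm_quad qB spB) (nth 0 [:: a; b]).
  by move/eqP; rewrite subr_eq0 => /eqP.
have [rk1|/not_all_ex_not[x /eqP rk2]] :=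
    classic (forall x : A, ttr A 1 * ttr A (x * x) = ttr A x * ttr A x); last first.
  by left=> f; split; [apply: quad_rank2 rk2 _ | apply: AB].
right; move/rank1_polarize: rk1 => rk1.
have [t1|t1] := eqVneq (ttr A 1) 0.
  by exists 1%N => //; apply: tr0_trequiv.
have [m /(nil_ker_trequiv charF AC rk1 t1)[n An]] := quad_nil_ker rk1 t1.
by exists n.+1.
Qed.

End Dichotomy.

(** * The algebras D_2 and C_2 *)

Section D2Quadratic.
Variables (F : fieldType) (charF : [pchar F] =i pred0).
Local Notation two_neq0 := (two_neq0 charF).

Let sgn : 'M[F]_2 := diag_mx (\row_i (-1) ^+ i).
Fact sgn_diag : sgn \in @diag2_pred F.
Proof. exact: diag_mx_is_diag. Qed.
Definition dsgn : diag2 F := Diag2 sgn_diag.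

Lemma D2_quad (a b : F) : quad_pres (dsgn : D2 a b) 1 (a - b) (a + b).
Proof.
split.
- rewrite scale1r; apply/val_inj; rewrite rmorphM rmorph1 /= -mulmxE mulmx_diag.
  apply/matrixP => i j; rewrite !mxE -expr2 sqrr_sign.
  by case: eqP.
- rewrite -[LHS]/(a * (1 : 'M[F]_2) 0 0 + b * (1 : 'M[F]_2) 1 1).
  by rewrite !mxE !mulr1.
by rewrite /= /diag2_tr !mxE /= !mulr1 mulrN1.
Qed.

Lemma D2_span (a b : F) : quad_span (dsgn : D2 a b).
Proof.
move=> x; exists ((val x 0 0 + val x 1 1) / 2), ((val x 0 0 - val x 1 1) / 2).
have xd : is_diag_mx (val x) by case: x.
apply/val_inj; rewrite -[RHS]/(_ *: (1 : 'M[F]_2) + _ *: sgn).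
apply/matrixP => i j; rewrite !mxE.
have [->|ij] := eqVneq i j; last first.
  by rewrite !mulr0 addr0; apply: (is_diag_mxP xd); apply: contra ij.
have: j = 0 \/ j = 1 by case: j => [[|[|[]]]] // ?; [left|right]; apply/val_inj.
by case=> -> /=; field; rewrite two_neq0.
Qed.

Definition id_trM (c : F) : texpr F :=
  TScal (SConst c * STr 0 [:: 1%N] - STr 0 [::] * STr 1 [::]).

(** Here tr / c is the projection of D_2 on its first factor, which gives id_trM.
    If the nilpotency index is unbounded on the kernel of tr in A, then the only
    polynomial g with g(y) = 0 for all y in this kernel is 0.  On the kernel, and
    at the idempotent e = diag(0, 1) generating D_2, the trace of g(y) is c g(0),
    so every identity of A holds in D_2. *)
Lemma D2_degenerate (A : traceAlg F) (c : F) : c != 0 -> in_trvar (D2 c 0) A ->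
  trequiv A (D2 c 0) \/ exists2 k, (1 <= k)%N & trequiv A (Ctr k.-1 (ttr A 1)).
Proof.
move=> c0 AB; have qB := D2_quad c 0; have spB := @D2_span c 0.
rewrite subr0 addr0 in qB.
have AC a b : a * b = b * a :> A.
  have := trvar_texpr AB (id_comm_quad qB spB) (nth 0 [:: a; b]).
  by move/eqP; rewrite subr_eq0 => /eqP.
have trM (x y : A) : c * ttr A (x * y) = ttr A x * ttr A y.
  have idB (rho : nat -> D2 c 0) : teval rho (id_trM c) = 0.
    have [p0 [q0 E0]] := spB (rho 0); have [p1 [q1 E1]] := spB (rho 1%N).
    rewrite /= E0 E1 (linM qB) !(tr_lin qB).
    by rewrite (_ : _ - _ = 0) ?scale0r //; ring.
  have /eqP := trvar_texpr AB idB (nth 0 [:: x; y]).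
  by rewrite /= scaler_eq0 oner_eq0 orbF subr_eq0 => /eqP.
have [t1|t1] := eqVneq (ttr A 1) 0.
  right; exists 1%N => //; apply: tr0_trequiv => // x y.
  have tr0 z : ttr A z = 0 by apply: (mulfI c0); rewrite -[z]mulr1 trM t1 !mulr0.
  by rewrite !tr0 mul0r.
have t1c : ttr A 1 = c by apply: (mulIf t1); rewrite -trM mulr1.
have rk1 x y : ttr A 1 * ttr A (x * y) = ttr A x * ttr A y by rewrite t1c.
have [[m nilk]|unb] := classic (exists m, forall y : A, ttr A y = 0 -> y ^+ m = 0).
  right; have [n An] := nil_ker_trequiv charF AC rk1 t1 nilk.
  by exists n.+1.
left=> f; split; last exact: AB.
move: f.
(* e = diag(0, 1), as dsgn = diag(1, -1). *)
pose e : D2 c 0 := lin (dsgn : D2 c 0) (1 / 2) (- 1 / 2).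
have ee : e * e = e by rewrite /e (linM qB); congr lin; field; rewrite two_neq0.
have he g : horner_alg e g = (g`_0)%:A + (g.[1] - g`_0) *: e.
  elim/poly_ind: g => [|g k IHg].
    by rewrite rmorph0 coef0 horner0 subrr !scale0r addr0.
  rewrite horner_alg_cons IHg mulrDl mulr_algl -scalerAl ee -scalerDl.
  rewrite coefD coefMX coefC add0r hornerD hornerMX hornerC mulr1 addrK addrC.
  by congr (_ + _ *: _); ring.
have tre : ttr (D2 c 0) e = 0.
  by rewrite (tr_lin qB); field; rewrite two_neq0.
apply: (@specialization_trvar F A (D2 c 0) {y : A | ttr A y == 0} sval e
         (fun g => (c * g`_0)%:P)).
- move=> x; have [p [q ->]] := spB x.
  exists ((p + q)%:P + (- 2 * q) *: 'X).
  rewrite rmorphD -mul_polyC rmorphM /= !horner_algC horner_algX mulr_algl.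
  rewrite /e (linC (dsgn : D2 c 0)).
  have -> : (- 2 * q) *: lin (dsgn : D2 c 0) (1 / 2) (-1 / 2) =
       lin (dsgn : D2 c 0) (- q) q.
    rewrite /lin scalerDr !scalerA; congr (_ *: _ + _ *: _); field; exact: two_neq0.
  by rewrite (linD (dsgn : D2 c 0)) addrK add0r.
- move=> g; rewrite horner_algC he linearD !linearZ /= tre mulr0 addr0.
  by rewrite (qp_tr1 qB) mulrC.
- by case=> y /eqP y0 g /=; rewrite (tr_horner_ker rk1 t1) // horner_algC t1c.
move=> g g0; suff -> : g = 0 by rewrite rmorph0.
apply/polyP => i; rewrite coef0.
apply: NNPP => gi; apply: unb; exists i => y y0.
have gy k : horner_alg (k *: y) g = 0.
  have ky : ttr A (k *: y) == 0 by rewrite linearZ /= y0 mulr0.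
  exact: (g0 (exist (fun y : A => ttr A y == 0) (k *: y) ky)).
have /eqP := horner_scale_eq0 charF gy i.
by rewrite scaler_eq0 => /orP[/eqP //|/eqP].
Qed.

End D2Quadratic.

Section C2Quadratic.
Variables (F : fieldType) (e : F).

Lemma C2_quad : quad_pres (tshift F 1 : C2 e) 0 1 e.
Proof.
split.
- by rewrite scale0r -expr2 tshift_nil.
- rewrite -[LHS]/(e * tcoef 0 0 1 + tcoef 0 1 1) -(expr0 (tshift F 1)).
  by rewrite !tcoefX mulr1 addr0.
rewrite -[LHS]/(e * tcoef 0 0 (tshift F 1) + tcoef 0 1 (tshift F 1)).
by rewrite -[tshift F 1]expr1 !tcoefX mulr0 add0r.
Qed.

Lemma C2_span : quad_span (tshift F 1 : C2 e).
Proof.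
move=> x; exists (tcoef 0 0 x), (tcoef 0 1 x).
have /toeplitzP[a aE] : val x \in @toeplitz_pred F 1 by case: x.
apply: tcoefP => i j.
rewrite /lin linearD !linearZ /= -(expr0 (tshift F 1)) -{2}[tshift F 1]expr1 !tcoefX.
rewrite /tcoef !aE addn0.
by case: i j => [[|[|[]]]] // ? [[|[|[]]]] //= ?; rewrite ?mulr1 ?mulr0 ?addr0 ?add0r.
Qed.

End C2Quadratic.

Theorem theorem28 (F : fieldType) (charF : [pchar F] =i pred0)
    (A : falgType F) (tr : {scalar A})
    (trC : forall a b : A, tr (a * b) = tr (b * a))
    (alpha' beta gamma delta epsilon : F)
    (alpha'_neq0 : alpha' != 0) (beta_neq0 : beta != 0)
    (gamma_neq0 : gamma != 0) (delta_neq0 : delta != 0)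
    (alpha'_neq_beta : alpha' != beta)
    (B : traceAlg F)
    (defB : [\/ B = D2 alpha' beta, B = D2 gamma gamma,
                B = D2 delta 0 | B = C2 epsilon]) :
  in_trvar B (TraceAlg trC) ->
  trequiv (TraceAlg trC) B \/
  exists2 k : nat, (1 <= k)%N & trequiv (TraceAlg trC) (Ctr k.-1 (tr 1)).
Proof.
have four0 : 4 != 0 :> F by rewrite ((pcharf0P F).1 charF).
have D2_nondeg a b : a != 0 -> b != 0 -> in_trvar (D2 a b) (TraceAlg trC) ->
    trequiv (TraceAlg trC) (D2 a b) \/
    exists2 k, (1 <= k)%N & trequiv (TraceAlg trC) (Ctr k.-1 (tr 1)).
  move=> a0 b0; have discE : (a + b) ^+ 2 * 1 - (a - b) ^+ 2 = 4 * (a * b) by ring.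
  apply: (quad_dichotomy charF (D2_quad a b) (@D2_span F charF a b) (lam := (a * b)^-1)).
    by rewrite discE !mulf_neq0.
  by rewrite discE mulr1 mulrC mulfK ?mulf_neq0.
case: defB => ->.
- exact: D2_nondeg.
- exact: D2_nondeg.
- exact: (D2_degenerate charF delta_neq0).
apply: (quad_dichotomy charF (C2_quad epsilon) (@C2_span F epsilon) (lam := 0)).
  by rewrite mulr0 expr1n sub0r oppr_eq0 oner_eq0.
by rewrite mul0r mulr0.
Qed.
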